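(* Let $q$ be any prime power. Let $m_1,n_1,m_3,n_3$ be positive integers, $m=m_1+m_3$, $n=n_1+n_3$, let $\mathcal F_1\subseteq[m_1]\times[n_1]$ be an $m_1\times n_1$ Ferrers diagram and $\mathcal F_3\subseteq[m_3]\times[n_3]$ an $m_3\times n_3$ Ferrers diagram, and let $$\mathcal F=\mathcal F_1\cup\{(m_1,n_1-1)\}\cup\big([m_1]\times\{n_1,\dots,n-1\}\big)\cup\{(m_1+i,n_1+j):(i,j)\in\mathcal F_3\},$$ an $m\times n$ Ferrers diagram with row counts $\rho_0,\dots,\rho_{m-1}$. Sort the multiset $\{1\}\cup\{\rho_i(\mathcal F_1):i\in[m_1]\}\cup\{\gamma_j(\mathcal F_3):j\in[n_3]\}$ (where $\rho_i(\mathcal F_1)$ is the number of dots in row $i$ of $\mathcal F_1$ and $\gamma_j(\mathcal F_3)$ the number of dots in column $j$ of $\mathcal F_3$) in nondecreasing order as $\alpha_0\le\alpha_1\le\cdots\le\alpha_{m_1+n_3}$. Let $\delta$ be a positive integer with $\delta\leq m_1+1$, and suppose (1) if $\delta<m_1+1$, then $n_3\geq m_1$; (2) $1+m_1+n_3\leq\max\{n_1,m_3\}$; (3) $\alpha_{m_1+n_3-\delta+2}\geq m_1+n_3$; (4) $\rho_{\delta-2}-n_3\geq m_3$. Then there exists an optimal $[\mathcal F,\sum_{i=\delta-1}^{m-1}\rho_i,\delta]_q$ code.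
   Context: $[a]$ denotes $\{0,1,\dots,a-1\}$; rows and columns of an $m\times n$ matrix are indexed by $[m]$ and $[n]$. An $m\times n$ Ferrers diagram is a set $\mathcal F\subseteq[m]\times[n]$ of cells (''dots'') such that: if $(i,j)\in\mathcal F$ and $i\ge1$ then $(i-1,j)\in\mathcal F$; if $(i,j)\in\mathcal F$ and $j\le n-2$ then $(i,j+1)\in\mathcal F$; row $0$ contains $n$ dots and column $n-1$ contains $m$ dots. $\gamma_j$ and $\rho_i$ denote the numbers of dots in column $j$ and row $i$. For an $m\times n$ Ferrers diagram $\mathcal F$, an $[\mathcal F,k,\delta]_q$ code is a $k$-dimensional $\mathbb F_q$-linear subspace $\mathcal C\subseteq\mathbb F_q^{m\times n}$ such that every matrix in $\mathcal C$ has zero entries in all positions not in $\mathcal F$, and every nonzero matrix of $\mathcal C$ has rank at least $\delta$. Such a code is called optimal if $k=\min_{i\in[\delta]}v_i$, where $v_i$ is the number of dots of $\mathcal F$ that lie neither in the first $i$ rows nor in the rightmost $\delta-1-i$ columns. *)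

(* Defs.v *)
From HB Require Import structures.
From mathcomp Require Import all_boot all_order all_algebra.

Set Implicit Arguments.
Unset Strict Implicit.
Unset Printing Implicit Defensive.

(* Row and column indices of dot counts are plain naturals; an out-of-range
   row or column has no dots. *)
Definition row_dots (m n : nat) (D : {set 'I_m * 'I_n}) (i : nat) : nat :=
  #|[set c in D | val c.1 == i]|.

Definition col_dots (m n : nat) (D : {set 'I_m * 'I_n}) (j : nat) : nat :=
  #|[set c in D | val c.2 == j]|.

Definition ferrers (m n : nat) (D : {set 'I_m * 'I_n}) : Prop :=
  [/\ forall (i i' : 'I_m) (j : 'I_n),
        val i' = (val i).+1 -> (i', j) \in D -> (i, j) \in D,
      forall (i : 'I_m) (j j' : 'I_n),
        val j' = (val j).+1 -> (i, j) \in D -> (i, j') \in D,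
      row_dots D 0 = n
    & col_dots D n.-1 = m].

(* D1 is the top-left block, D3 the bottom-right one, the top-right block is
   full, and the bottom-left block has a single dot, in its top-right corner. *)
Definition ferrers_glue (m1 n1 m3 n3 : nat)
    (D1 : {set 'I_m1 * 'I_n1}) (D3 : {set 'I_m3 * 'I_n3}) :
    {set 'I_(m1 + m3) * 'I_(n1 + n3)} :=
  [set (lshift m3 c.1, lshift n3 c.2) | c in D1]
  :|: [set c : 'I_(m1 + m3) * 'I_(n1 + n3) |
         (val c.1 == m1) && (val c.2 == n1.-1)]
  :|: [set c : 'I_(m1 + m3) * 'I_(n1 + n3) | (c.1 < m1) && (n1 <= c.2)]
  :|: [set (rshift m1 c.1, rshift n1 c.2) | c in D3].

Definition alpha_seq (m1 n1 m3 n3 : nat)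
    (D1 : {set 'I_m1 * 'I_n1}) (D3 : {set 'I_m3 * 'I_n3}) : seq nat :=
  sort leq (1 :: [seq row_dots D1 i | i <- iota 0 m1]
              ++ [seq col_dots D3 j | j <- iota 0 n3]).

(* v_i: the dots outside the first i rows and the rightmost d - 1 - i columns. *)
Definition ferrers_v (m n : nat) (D : {set 'I_m * 'I_n}) (d i : nat) : nat :=
  #|[set c in D | (i <= c.1) && (c.2 + (d - 1 - i) < n)]|.

Definition ferrers_code (F : fieldType) (m n : nat) (D : {set 'I_m * 'I_n})
    (k d : nat) (C : {vspace 'M[F]_(m, n)}) : Prop :=
  [/\ \dim C = k,
      forall A : 'M[F]_(m, n), A \in C ->
        forall i j, (i, j) \notin D -> A i j = 0%R
    & forall A : 'M[F]_(m, n), A \in C -> A != 0%R -> d <= \rank A].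

(* For d > 0 the default value v_0 of the iterated minimum is itself one of
   the terms. *)
Definition optimal_ferrers_code (F : fieldType) (m n : nat)
    (D : {set 'I_m * 'I_n}) (k d : nat) (C : {vspace 'M[F]_(m, n)}) : Prop :=
  ferrers_code D k d C /\
  k = \big[minn/ferrers_v D d 0]_(i < d) ferrers_v D d i.

(* Main.v *)
Require Import Defs.
From HB Require Import structures.
From mathcomp Require Import all_boot all_order all_fingroup all_solvable all_algebra all_field.
From mathcomp Require Import zify.

(** A matrix [[A, B], [E, D]] supported on the glued diagram has a free m1 x n3
    block B, and its other nonzero entries (a single one in E) are listed as
    m1 + n3 + 1 columns of length n1: the entry of E, the rows of A read from
    the right, and the columns of D.  If B = 0 then the rank is at least that
    of the list of columns; if B != 0 it is at least rank B.  So it suffices to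
    let B run through an MRD code and the list of columns through a code with
    prescribed column heights, in which the d - 1 longest columns (the first
    d - 1 rows of A, by hypothesis (4)) are the redundant ones.

    With n = m1 + n3 and M = rho_{d-2}(F1), sorting gives M >= n, whereas the
    n + 1 columns would call for a Gabidulin code over an extension of degree
    n + 1.  The missing dimension comes from the column of height 1 and from
    the longest column, of height n1 > n.  In an extension L of degree M take
    a basis b_0, ..., b_{M-1}, the map Lam x = x^q - b_0^(q-1) x with kernel
    spanned by b_0, and all linearized polynomials f of q-degree < r = n + 1 - d;
    with e in F_q, column j is f (Lam b_j) + e b_j.  For M = n the last column
    is instead f (w) + e b_n, where w lies outside the image of Lam and b_n is
    an extra coordinate.  Counting roots of f and of e X + f o Lam bounds the
    rank, and shortening gives the prescribed heights.  The dimension obtained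
    equals v_{d-1}, an upper bound for it is every v_i, hence optimality. *)

Set Implicit Arguments.
Unset Strict Implicit.
Unset Printing Implicit Defensive.

Import GRing.Theory VectorInternalTheory.
Local Open Scope ring_scope.

(** * Finite field extensions of prescribed degree *)

(** The additive group of [F] is elementary abelian for the characteristic that [F] shares with [L].
    This is what makes [x |-> x ^+ (q ^ i)] additive on [L]. *)
Lemma pnat_pchar_card (F : finFieldType) (L : fieldExtType F) : [pchar L].-nat #|F|.
Proof.
have [c pr_c cF] := finPcharP F.
have cL : c \in [pchar L] by rewrite pchar_lalg.
rewrite (eq_pnat _ (pcharf_eq cL)) -cardsT.
by have := abelem_pgroup (fin_ring_pchar_abelem cF); rewrite /pgroup.
Qed.

(** [L] is the splitting field of ['X^m - 'X] with [m = #|F| ^ M]. The roots are the fixed points of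
    the [M]-th power of a Frobenius generator of the Galois group, so they form a subfield; since
    they generate [L], they exhaust it. *)
Lemma fieldExt_exists (F : finFieldType) (M : nat) :
  (0 < M)%N -> exists L : fieldExtType F, \dim {:L} = M.
Proof.
move=> M_gt0; pose m := (#|F| ^ M)%N.
have F_gt1 : (1 < #|F|)%N := finNzRing_gt1 F.
have m_gt1 : (1 < m)%N by rewrite -(expn0 #|F|) ltn_exp2l.
have sz_p (R : nzRingType) : size ('X^m - 'X : {poly R}) = m.+1.
  by rewrite size_polyDl size_polyXn // size_polyN size_polyX.
have /FinSplittingFieldFor[L [zs Dp defL]] : 'X^m - 'X != 0 :> {poly F}.
  by rewrite -size_poly_eq0 sz_p.
rewrite /= rmorphB rmorphXn /= map_polyX in Dp.
exists L.
have [a _ Da] := finField_galois_generator (sub1v {:L}).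
rewrite dimv1 expn1 in Da.
have mL0 : m%:R = 0 :> L.
  have /pnatP-/(_ (ltnW m_gt1) (pdiv m)) : [pchar L].-nat m.
    by rewrite pnatX pnat_pchar_card.
  rewrite pdiv_prime ?pdiv_dvd // => /(_ isT isT) cL.
  by apply/eqP; rewrite -(dvdn_pcharf cL) pdiv_dvd.
(* As [m] vanishes in [L], the derivative of ['X^m - 'X] is -1, so the [m] roots are distinct. *)
have Uzs: uniq zs.
  rewrite -separable_prod_XsubC -(eqp_separable Dp) unlock derivB derivXn derivX.
  rewrite -mulr_natl -polyC_natr mL0 mul0r sub0r.
  have -> : (-1 : {poly L}) = (-1 : L) *: 1 by rewrite scaleN1r.
  by rewrite coprimepZr ?coprimep1 // oppr_eq0 oner_eq0.
pose E := fixedSpace (a ^+ M)%g.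
have in_zs: zs =i E.
  move=> z; rewrite -root_prod_XsubC -(eqp_root Dp) (sameP fixedSpaceP eqP).
  rewrite /root !hornerE subr_eq0 /= /m; congr (_ == z).
  elim: (M) => [|i IHi]; first by rewrite gal_id.
  by rewrite expgSr expnSr exprM IHi galM ?Da ?memvf.
have zsL z : z \in zs.
  have sLE : ({:L} <= E)%VS.
    rewrite -defL -[E]subfield_closed agenvS // subv_add sub1v.
    by apply/span_subvP=> x; rewrite in_zs.
  by rewrite in_zs (subvP sLE) ?memvf.
apply/eqP; rewrite dimvf -(eqn_exp2l _ _ F_gt1) -/m; apply/eqP.
have -> : m = size zs.
  apply: succn_inj; rewrite -(size_prod_XsubC _ id) -(eqp_size Dp).
  by rewrite sz_p.
have -> : (#|F| ^ dim L = size [seq (r2v u : L) | u : 'rV[F]_(dim L)])%N.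
  by rewrite size_map -cardE card_mx mul1n.
apply/perm_size/uniq_perm => //.
  by rewrite map_inj_uniq ?enum_uniq //; apply: (can_inj r2vK).
move=> z; rewrite zsL; apply/mapP; exists (v2r z); first by rewrite mem_enum.
by rewrite v2rK.
Qed.

(** * Linearized polynomials and rank bounds by counting roots *)

Section LinearizedPolynomials.

Variables (F : finFieldType) (L : fieldExtType F) (r : nat).
Local Notation q := #|F|.
Implicit Types (f : {ffun 'I_r -> L}) (x : L).

Lemma expr_card_linear i : linear (fun x : L => x ^+ (q ^ i)).
Proof.
move=> a x y; rewrite exprDn_pchar ?pnatX ?pnat_pchar_card //.
rewrite exprZn; congr (_ *: _ + _).
by elim: i => // i IHi; rewrite expnSr exprM IHi expf_card.
Qed.

Definition qfun f x := \sum_i f i * x ^+ (q ^ i).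

Fact qfun_linear f : linear (qfun f).
Proof.
move=> a x y; rewrite /qfun scaler_sumr -big_split; apply: eq_bigr => i _ /=.
by rewrite expr_card_linear mulrDr scalerAr.
Qed.

HB.instance Definition _ f :=
  GRing.isLinear.Build F L L *:%R (qfun f) (qfun_linear f).

(** The map [qfun f] as an honest polynomial, so that its roots can be counted. *)
Definition qpoly f : {poly L} := \sum_i f i *: 'X^(q ^ i).

Lemma horner_qpoly f x : (qpoly f).[x] = qfun f x.
Proof. by rewrite horner_sum; apply: eq_bigr => i _; rewrite hornerZ hornerXn. Qed.

Lemma qpoly_neq0 f : f != 0 -> qpoly f != 0.
Proof.
apply: contra_neq => f0; apply/ffunP => i; rewrite ffunE.
have := congr1 (fun p : {poly L} => p`_(q ^ i)) f0.
rewrite coef_sum coef0 (bigD1 i) //= big1 => [|j ji].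
  by rewrite coefZ coefXn eqxx mulr1 addr0.
rewrite coefZ coefXn eqn_exp2l ?finNzRing_gt1 //.
by rewrite (inj_eq val_inj) eq_sym (negPf ji) mulr0.
Qed.

Lemma size_qpoly f : (size (qpoly f) <= (q ^ r.-1).+1)%N.
Proof.
apply: leq_trans (size_sum _ _ _) _; apply/bigmax_leqP => i _.
apply: leq_trans (size_scale_leq _ _) _.
rewrite size_polyXn ltnS leq_exp2l ?finNzRing_gt1 // -ltnS.
by rewrite (ltn_predK (ltn_ord i)).
Qed.

End LinearizedPolynomials.

(** The left kernel of [Y] has [#|F| ^ (dim L - \rank Y)] elements, which give distinct roots of
    [p], and [p] has at most [#|F| ^ r] of them. *)
Lemma rank_ge_of_roots (F : finFieldType) (L : fieldExtType F) (k r : nat)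
    (Y : 'M[F]_(dim L, k)) (p : {poly L}) :
    p != 0 -> (size p <= (#|F| ^ r).+1)%N ->
    (forall u, u *m Y = 0 -> root p (r2v u)) ->
  (dim L <= \rank Y + r)%N.
Proof.
move=> p0 sz_p rootp; set K := row_base (kermx Y).
rewrite -leq_subLR -mxrank_ker -(leq_exp2l _ _ (finNzRing_gt1 F)).
pose rs := [seq (r2v (u *m K) : L) | u : 'rV[F]_(\rank (kermx Y))].
have -> : (#|F| ^ \rank (kermx Y) = size rs)%N.
  by rewrite size_map -cardE card_mx mul1n.
rewrite -ltnS (leq_trans _ sz_p) //; apply: max_poly_roots => //.
  apply/allP=> _ /mapP[u _ ->]; apply: rootp; apply/sub_kermxP.
  by rewrite (submx_trans (submxMl _ _)) // eq_row_base.
rewrite map_inj_uniq ?enum_uniq // => u v /r2v_inj.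
exact: row_free_inj (row_base_free _) _ _.
Qed.

(* [V] is the Gabidulin code of the maps [qfun f], and [Lam] is the matrix of
   [x |-> x^q - theta^(q-1) x], where [theta] is the basis vector of index [i0]. *)
Lemma qpoly_spread (F : finFieldType) (M r : nat) (i0 : 'I_M) :
    (0 < r <= M)%N ->
  exists (Lam : 'M[F]_M) (V : {vspace 'M[F]_M}),
    [/\ row i0 Lam = 0, (M <= \rank Lam + 1)%N, \dim V = (r * M)%N,
        forall X, X \in V -> X != 0 -> (M < \rank X + r)%N
      & forall X e, X \in V -> e != 0 -> (M <= \rank (e%:M + Lam *m X)%R + r)%N].
Proof.
case/andP=> r_gt0 leqrM.
have [L dimL] := fieldExt_exists F (leq_ltn_trans (leq0n _) (ltn_ord i0)).
rewrite dimvf in dimL; subst M.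
have q_gt1 := finNzRing_gt1 F; set q := #|F| in q_gt1 *.
pose theta : L := r2v (delta_mx 0 i0).
have theta0 : theta != 0.
  apply/eqP=> /(congr1 v2r); rewrite r2vK linear0 => /matrixP/(_ 0 i0).
  by rewrite !mxE !eqxx; apply/eqP; rewrite oner_eq0.
pose lamp : {poly L} := 'X^q - theta ^+ q.-1 *: 'X.
have sz_lamp : size lamp = q.+1.
  rewrite size_polyDl size_polyXn // size_polyN.
  by apply: leq_ltn_trans (size_scale_leq _ _) _; rewrite size_polyX.
have lamp0 : lamp != 0 by rewrite -size_poly_eq0 sz_lamp.
have lam_lin : linear (horner lamp).
  move=> a x y; rewrite !hornerE -(expn1 q) expr_card_linear expn1.
  rewrite scalerBr mulrDr opprD -scalerAr !addrA; congr (_ - _).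
  by rewrite addrAC.
pose lam : {linear L -> L} := HB.pack (horner lamp)
  (GRing.isLinear.Build F L L *:%R (horner lamp) lam_lin).
pose Lam : 'M[F]_(dim L) := lin1_mx (v2r \o lam \o r2v).
pose X f : 'M[F]_(dim L) := lin1_mx (v2r \o @qfun F L r f \o r2v).
have mulLam u : u *m Lam = v2r lamp.[r2v u] by rewrite mul_rV_lin1.
have mulX f u : u *m X f = v2r (qfun f (r2v u)) by rewrite mul_rV_lin1.
have X_lin : linear X.
  move=> a f g; apply/row_matrixP => i; rewrite linearD linearZ /= !rowE !mulX.
  rewrite -linearZ -linearD /=; congr (v2r _); rewrite /qfun scaler_sumr -big_split.
  by apply: eq_bigr => k _; rewrite !ffunE mulrDl scalerAl.
pose XL : {linear _ -> _} := HB.pack X (GRing.isLinear.Build F _ _ *:%R X X_lin).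
have rkX f : f != 0 -> (dim L <= \rank (X f) + r.-1)%N.
  move=> f0; apply: (rank_ge_of_roots (qpoly_neq0 f0) (size_qpoly f)) => u.
  by rewrite mulX => /(congr1 r2v); rewrite v2rK linear0 rootE horner_qpoly => ->.
have lam_theta : lamp.[theta] = 0.
  by rewrite !hornerE -exprSr (ltn_predK q_gt1) subrr.
exists Lam, (limg (linfun XL)); split.
- by rewrite rowE mulLam lam_theta linear0.
- apply: (rank_ge_of_roots lamp0); first by rewrite sz_lamp expn1.
  by move=> u; rewrite mulLam => /(congr1 r2v); rewrite v2rK linear0 rootE => ->.
- rewrite limg_dim_eq.
    by rewrite dimvf /dim /= card_ord.
  apply/eqP; rewrite -subv0; apply/subvP => f; rewrite memv_cap memvf memv_ker lfunE /=.
  rewrite memv0; apply: contraTT => /rkX; apply: contraTneq => ->.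
  by rewrite mxrank0 add0n -ltnNge (leq_trans _ leqrM) // prednK.
- move=> _ /memv_imgP[f _ ->]; rewrite lfunE /= => Xf0.
  rewrite -(prednK r_gt0) addnS ltnS rkX //.
  by apply: contra_neq Xf0 => ->; apply: (linear0 XL).
move=> _ e /memv_imgP[f _ ->] e0; rewrite lfunE /=.
(* The left kernel of [e%:M + Lam *m X f] consists of roots of [p]. Composition with [lamp] raises
   the q-degree from at most [r - 1] to at most [r]; and [p] is nonzero because [lamp] kills
   [theta], whence [p.[theta] = e *: theta]. *)
pose p : {poly L} := e%:A *: 'X + (qpoly f \Po lamp).
have pE x : p.[x] = e *: x + qfun f lamp.[x].
  by rewrite hornerD hornerZ hornerX -scalerAl mul1r horner_comp horner_qpoly.
apply: (rank_ge_of_roots (p := p)) => [||u].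
- apply/eqP=> /(congr1 (horner^~ theta)); rewrite pE lam_theta horner0 linear0 addr0.
  by move/eqP; rewrite scaler_eq0 (negPf e0) (negPf theta0).
- apply: leq_trans (size_polyD _ _) _; rewrite geq_max; apply/andP; split.
    apply: leq_trans (size_scale_leq _ _) _.
    by rewrite size_polyX ltnS expn_gt0 ltnW.
  apply: leq_trans (size_comp_poly_leq _ _) _; rewrite ltnS sz_lamp /=.
  rewrite -[in X in (_ <= X)%N](prednK r_gt0) expnSr leq_mul2r.
  by rewrite -subn1 leq_subLR add1n size_qpoly orbT.
rewrite mulmxDr mul_mx_scalar mulmxA mulX mulLam v2rK => /(congr1 r2v).
by rewrite linearD linearZ /= v2rK linear0 rootE pE => ->.
Qed.

(** * Counting cells and forcing entries to vanish *)

Lemma card_row_sum (m n : nat) (D : {set 'I_m * 'I_n}) :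
  #|D| = (\sum_(i < m) #|[set j | (i, j) \in D]|)%N.
Proof.
rewrite -sum1_card (eq_bigl (fun c => xpredT c.1 && ((c.1, c.2) \in D))); last by case.
rewrite -(pair_big_dep xpredT (fun i j => (i, j) \in D) (fun _ _ => 1%N)).
by apply: eq_bigr => i _; rewrite -sum1_card; apply: eq_bigl => j; rewrite inE.
Qed.

Lemma card_ord_interval (n a b : nat) :
  (b <= n)%N -> #|[set j : 'I_n | a <= j < b]%N| = (b - a)%N.
Proof.
move=> lebn; rewrite -sum1_card (eq_bigl (fun j : 'I_n => a <= j < b)%N); last first.
  by move=> j; rewrite inE.
rewrite -(big_mkord (fun j => a <= j < b)%N (fun _ => 1%N)).
rewrite -[RHS]muln1 -sum_nat_const_nat.
rewrite (big_nat_widen _ _ _ _ _ lebn) (big_nat_widenl a 0) //.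
by apply: eq_bigl => j; rewrite andbC.
Qed.

Section VanishingEntries.

Variables (F : fieldType) (m n : nat) (S : {set 'I_m * 'I_n}).

Definition entries_at (A : 'M[F]_(m, n)) : 'rV[F]_(#|S|) :=
  \row_k A (enum_val k).1 (enum_val k).2.

Fact entries_at_linear : linear entries_at.
Proof. by move=> a A B; apply/rowP=> k; rewrite !mxE. Qed.

HB.instance Definition _ :=
  GRing.isLinear.Build F 'M[F]_(m, n) 'rV[F]_(#|S|) *:%R entries_at entries_at_linear.

Definition zero_on : {vspace 'M[F]_(m, n)} := lker (linfun entries_at).

Lemma zero_onP (A : 'M[F]_(m, n)) :
  reflect (forall i j, (i, j) \in S -> A i j = 0) (A \in zero_on).
Proof.
rewrite memv_ker lfunE /=; apply: (iffP eqP) => [A0 i j Sij | A0].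
  by have /rowP/(_ (enum_rank_in Sij (i, j))) := A0; rewrite !mxE enum_rankK_in.
apply/rowP=> k; rewrite !mxE; have := enum_valP k.
by case: (enum_val k) => i j /A0.
Qed.

(** Shortening: each entry forced to vanish costs at most one dimension. It serves both to build
    codes of prescribed support and to bound the dimension of any code from above. *)
Lemma dimv_zero_on (U : {vspace 'M[F]_(m, n)}) :
  (\dim U <= \dim (U :&: zero_on) + #|S|)%N.
Proof.
rewrite -(limg_ker_dim (linfun entries_at) U) leq_add2l.
apply: leq_trans (dimvS (subvf _)) _.
by rewrite dimvf /dim /= mul1n.
Qed.

End VanishingEntries.

(** * Codes with prescribed column heights, and MRD codes *)

Lemma row_pid_mx (F : fieldType) (m n r : nat) (i : 'I_m) (j : 'I_n) :
  (i < r)%N -> val i = val j -> row i (pid_mx r : 'M[F]_(m, n)) = delta_mx 0 j.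
Proof.
move=> ltir eq_ij; apply/rowP=> k; rewrite !mxE ltir andbT eqxx /= eq_ij.
by rewrite eq_sym.
Qed.

Lemma col_mulmx (R : pzRingType) (m n p : nat) (A : 'M[R]_(m, n)) (B : 'M[R]_(n, p))
    (j : 'I_p) :
  col j (A *m B) = A *m col j B.
Proof. by rewrite !colE mulmxA. Qed.

(* When [M = n], the identity sticks out of the image of [pid_mx M] by one
   coordinate, which compensates for the missing dimension of [Lam]. *)
Lemma extended_spread (F : fieldType) (M N n r : nat) (i0 : 'I_M)
    (Lam : 'M[F]_M) (V : {vspace 'M[F]_M}) :
    val i0 = 0%N -> row i0 Lam = 0 -> (M <= \rank Lam + 1)%N ->
    (forall X e, X \in V -> e != 0 -> (M <= \rank (e%:M + Lam *m X)%R + r)%N) ->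
    (n <= M <= N)%N -> (n < N)%N ->
  exists P : 'M[F]_(n.+1, M), [/\ row ord0 P = 0, (n <= \rank P)%N
    & forall X e, X \in V -> e != 0 ->
      (n < \rank (e *: pid_mx n.+1 + P *m X *m (pid_mx M : 'M_(M, N)))%R + r)%N].
Proof.
move=> i0E Lam0 rkLam rkV /andP[lenM leMN] ltnN.
case: (ltngtP n M) lenM => // [ltnM _ | eq_nM _].
  have rk_pid : \rank (pid_mx n.+1 : 'M[F]_(n.+1, M)) = n.+1.
    by rewrite rank_pid_mx.
  (* If [n < M], the first [n.+1] rows of [Lam] are available, and dropping the other rows lowers a
     rank by at most [M - n.+1]. *)
  exists (pid_mx n.+1 *m Lam); split.
  - by rewrite row_mul (@row_pid_mx _ _ _ _ _ i0) // -rowE.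
  - have := mxrank_mul_min (pid_mx n.+1 : 'M[F]_(n.+1, M)) Lam.
    by rewrite rk_pid; lia.
  move=> X e VX e0; set H := (X in \rank X).
  have -> : H = pid_mx n.+1 *m (e%:M + Lam *m X) *m (pid_mx M : 'M_(M, N)).
    rewrite mulmxDr mulmxDl mul_mx_scalar -scalemxAl mul_pid_mx !mulmxA.
    by have -> : minn M (minn n.+1 M) = n.+1 by lia.
  rewrite mxrankMfree; last by rewrite /row_free rank_pid_mx.
  have := mxrank_mul_min (pid_mx n.+1 : 'M[F]_(n.+1, M)) (e%:M + Lam *m X).
  by rewrite rk_pid; have := rkV X e VX e0; lia.
subst M; have rkLam_lt : (\rank Lam < n)%N.
  rewrite ltn_neqAle rank_leq_row andbT; apply/negP => /row_free_inj injLam.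
  have /injLam/matrixP/(_ 0 i0) : delta_mx 0 i0 *m Lam = (0 : 'rV_n) *m Lam.
    by rewrite -rowE Lam0 mul0mx.
  by rewrite !mxE !eqxx; apply/eqP; rewrite oner_eq0.
have [w wLam] : exists w : 'rV_n, ~~ (w <= Lam)%MS.
  suffices /row_subPn[i] : ~~ (1%:M <= Lam)%MS by exists (row i 1%:M).
  by rewrite sub1mx -col_leq_rank -ltnNge.
(* The rows of [Lam] followed by [w]: the rank of [Lam] is at least [n - 1], and [w] outside its row
   space raises it to [n]. *)
pose P : 'M[F]_(n.+1, n) :=
  \matrix_j oapp (fun k => row k Lam) w (unlift ord_max j).
have rowP k : row (lift ord_max k) P = row k Lam by rewrite rowK liftK.
have rowPmax : row ord_max P = w by rewrite rowK unlift_none.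
have pidP : (pid_mx n : 'M_(n, n.+1)) *m P = Lam.
  apply/row_matrixP => k; rewrite row_mul (@row_pid_mx _ _ _ _ _ (lift ord_max k)) //.
    by rewrite -rowE rowP.
  exact/esym/lift_max.
exists P; split.
- have -> : ord0 = lift ord_max i0 :> 'I_n.+1 by apply: val_inj; rewrite [RHS]lift_max i0E.
  by rewrite rowP.
- have /rank_ltmx : (Lam < P)%MS.
    rewrite ltmxE -pidP submxMl /= pidP; apply: contra wLam; rewrite -rowPmax.
    exact: submx_trans (row_sub _ _).
  by lia.
move=> X e VX e0; set H := (X in \rank X).
(* Column [n] of [H] comes from the identity part alone, with [e] in the last row as its only
   nonzero entry. Hence the left kernel of [H] has zero last coordinate and embeds into that of
   [e%:M + Lam *m X]. *)
have colH : col (Ordinal ltnN) H = e *: delta_mx ord_max 0.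
  rewrite /H linearD linearZ /= col_mulmx.
  have -> : col (Ordinal ltnN) (pid_mx n : 'M[F]_(n, N)) = 0.
    by apply/colP=> k; rewrite !mxE /= ltn_eqF.
  rewrite mulmx0 addr0; congr (_ *: _); apply/colP=> k.
  by rewrite !mxE /= ltn_ord eqxx !andbT.
have [K KE] : exists K, K = kermx H by exists (kermx H).
have KH : K *m H = 0 by rewrite KE mulmx_ker.
have colK : col ord_max K = 0.
  have := congr1 (col (Ordinal ltnN)) KH.
  rewrite col_mulmx colH -scalemxAr -colE linear0 => /eqP.
  by rewrite scaler_eq0 (negPf e0) => /eqP.
pose K' := K *m (pid_mx n : 'M_(n.+1, n)).
have K'K : K' *m (pid_mx n : 'M_(n, n.+1)) = K.
  rewrite -mulmxA mul_pid_mx !minnn; apply/matrixP=> k j; rewrite mxE.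
  rewrite (bigD1 j) //= big1 => [|l lj]; rewrite mxE; last first.
    have -> : (l == j :> nat) = (l == j) by [].
    by rewrite (negPf lj) mulr0.
  rewrite eqxx addr0 /=; have := ltn_ord j; rewrite ltnS leq_eqVlt.
  case/orP=> [/eqP eq_jn | ->]; last by rewrite mulr1.
  have -> : j = ord_max by apply: val_inj.
  by have /colP/(_ k) := colK; rewrite !mxE => ->; rewrite mul0r.
have pidH : (pid_mx n : 'M_(n, n.+1)) *m H = (e%:M + Lam *m X) *m (pid_mx n : 'M_(n, N)).
  rewrite /H mulmxDr mulmxDl -scalemxAr mul_scalar_mx !mulmxA pidP mul_pid_mx.
  by have -> : minn n.+1 (minn n n.+1) = n by lia.
have K'0 : K' *m (e%:M + Lam *m X) = 0.
  have freeN : row_free (pid_mx n : 'M[F]_(n, N)) by rewrite /row_free rank_pid_mx.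
  apply: (row_free_inj freeN).
  by rewrite -mulmxA -pidH mulmxA K'K KH mul0mx.
have := mulmx0_rank_max K'0; have := rkV X e VX e0.
have : (\rank K <= \rank K')%N by rewrite -K'K mxrankM_maxl.
have := rank_leq_row H; rewrite KE mxrank_ker; lia.
Qed.

(* The matrices are stored transposed: row [j] is the column of height [a j]. *)
Lemma column_code (F : finFieldType) (N n M r : nat) (a : nat -> nat) :
    (0 < r <= n)%N -> (n <= M <= N)%N -> (n < N)%N -> (0 < a 0)%N -> (n < a n)%N ->
    (forall j, 0 < j <= r -> a j <= M)%N -> (forall j, r < j <= n -> M <= a j)%N ->
  exists V : {vspace 'M[F]_(n.+1, N)},
    [/\ (1 + \sum_(1 <= j < r.+1) a j <= \dim V)%N,
        forall A, A \in V -> forall j i, (a (val j) <= val i)%N -> A j i = 0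
      & forall A, A \in V -> A != 0 -> (n < \rank A + r)%N].
Proof.
case/andP=> r_gt0 lern lenMN ltnN a0 an a_le a_ge; have [lenM leMN] := andP lenMN.
have M_gt0 : (0 < M)%N by lia.
pose i0 := Ordinal M_gt0.
have /(qpoly_spread F i0)[Lam [W [Lam0 rkLam dimW rkW rkLamW]]] : (0 < r <= M)%N by lia.
have [P [P0 rkP rkPW]] :=
  extended_spread (erefl : val i0 = 0%N) Lam0 rkLam rkLamW lenMN ltnN.
pose emb (X : 'M[F]_M) : 'M[F]_(n.+1, N) := P *m X *m pid_mx M.
have emb_lin : linear emb.
  by move=> e X Y; rewrite /emb linearP /= mulmxDl -scalemxAl.
pose embL : {linear _ -> _} := HB.pack emb (GRing.isLinear.Build F _ _ *:%R emb emb_lin).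
have emb0 : emb 0 = 0 := linear0 embL.
have embN X : emb (- X) = - emb X := linearN embL X.
pose f := linfun embL; pose B : 'M[F]_(n.+1, N) := pid_mx n.+1.
have rk_ge X e : X \in W -> (X != 0) || (e != 0) -> (n < \rank (e *: B + emb X)%R + r)%N.
  move=> WX; have [-> | e0 _] := eqVneq e 0; last exact: rkPW.
  rewrite orbF scale0r add0r => /(rkW X WX) rkX.
  rewrite mxrankMfree; last by rewrite /row_free rank_pid_mx.
  have := mxrank_mul_min P X; lia.
have eq0 X e : X \in W -> e *: B + emb X = 0 -> X = 0 /\ e = 0.
  move=> WX XB0; have := rk_ge X e WX; rewrite XB0 mxrank0 add0n ltnNge lern.
  by case: (eqVneq X 0) => [->|_]; case: (eqVneq e 0) => [->|_] //= /(_ isT).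
pose U := (<[B]> + f @: W)%VS.
have dimU : \dim U = (1 + r * M)%N.
  rewrite dimv_disjoint_sum.
    rewrite limg_dim_eq ?dimW ?dim_vline.
      case: eqVneq => // B0; have := eq0 0 1 (mem0v _).
      by rewrite B0 scaler0 emb0 addr0 => /(_ erefl)[_ /eqP]; rewrite oner_eq0.
    apply/eqP; rewrite -subv0; apply/subvP=> X; rewrite memv_cap memv_ker lfunE /=.
    case/andP=> WX /eqP X0; have [|-> _] := eq0 X 0 WX; last exact: mem0v.
    by rewrite scale0r add0r.
  apply/eqP; rewrite -subv0; apply/subvP=> X; rewrite memv_cap.
  case/andP=> /vlineP[e ->] /memv_imgP[Y WY]; rewrite lfunE /= => eB.
  have [||_ ->] := eq0 (- Y) e; rewrite ?memvN ?scale0r ?mem0v //.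
  by rewrite eB embN subrr.
(* Rows 1 to [r] alone are shortened, at a cost of [r * M] minus the sum of their heights. The other
   rows respect their heights already: row 0 of [P] is zero, and the rows after [r] have height at
   least [M]. *)
pose S : {set 'I_n.+1 * 'I_N} := [set c | (0 < val c.1 <= r) && (a (val c.1) <= val c.2 < M)]%N.
have cardS : (#|S| + \sum_(1 <= j < r.+1) a j = r * M)%N.
  rewrite card_row_sum.
  have -> : (\sum_(i < n.+1) #|[set j | (i, j) \in S]| = \sum_(1 <= j < r.+1) (M - a j))%N.
    rewrite (big_nat_widen 1 r.+1 n.+1) // (big_nat_widenl 1 0) // big_mkord.
    rewrite [RHS]big_mkcond /=; apply: eq_bigr => j _.
    rewrite andbC ltnS; case: ifP => jr; last first.
      by apply: eq_card0 => i; rewrite !inE /= jr.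
    rewrite -(card_ord_interval _ leMN); apply: eq_card => i.
    by rewrite !inE /= jr.
  rewrite -big_split /= -[r in (r * M)%N](subn1 r.+1) -sum_nat_const_nat.
  by apply: eq_big_nat => j jr; rewrite subnK // a_le.
exists (U :&: zero_on F S)%VS; split.
- rewrite -(leq_add2r #|S|) -addnA [X in (1 + X)%N]addnC cardS -dimU.
  exact: dimv_zero_on.
- move=> A /memv_capP[/memv_addP[_ /vlineP[e ->] [_ /memv_imgP[X WX ->] ->]] /zero_onP zA] j i /= le_ai.
  have [/zA // | Sij] := boolP ((j, i) \in S); rewrite inE /= le_ai /= in Sij.
  have Mi : (0 < j)%N -> (M <= i)%N.
    move=> j_gt0; have [lejr | ltrj] := leqP j r; first by lia.
    by apply: leq_trans le_ai; apply: a_ge; rewrite ltrj -ltnS ltn_ord.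
  (* A diagonal entry of [B] above its height would be at 0, excluded by [0 < a 0], or at some
     [j >= M >= n], that is [j = n], excluded by [n < a n]. *)
  have neq_ji : (j == i :> nat) = false.
    apply/eqP=> eq_ji; have [j0 | /Mi leMi] := posnP j.
      by move: le_ai; rewrite -eq_ji j0 leqNgt a0.
    have jn : j = n :> nat by have := ltn_ord j; lia.
    by move: le_ai; rewrite -eq_ji jn leqNgt an.
  rewrite lfunE /= /emb mxE [X in X + _]mxE [X in e * X]mxE neq_ji mulr0 add0r.
  have [-> | j_neq0] := eqVneq j ord0.
    have : row ord0 (P *m X *m (pid_mx M : 'M_(M, N))) = 0.
      by rewrite !row_mul P0 !mul0mx.
    by move/rowP/(_ i); rewrite mxE [RHS]mxE.
  have : col i (P *m X *m (pid_mx M : 'M_(M, N))) = 0.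
    rewrite col_mulmx (_ : col i _ = 0) ?mulmx0 //.
    apply/colP=> k; rewrite !mxE ltn_eqF // (leq_trans (ltn_ord k)) //.
    by apply: Mi; rewrite lt0n.
  by move/colP/(_ j); rewrite mxE [RHS]mxE.
move=> _ /memv_capP[/memv_addP[_ /vlineP[e ->] [_ /memv_imgP[X WX ->] ->]] _].
rewrite lfunE /= => A0; apply: rk_ge => //; apply: contraNT A0.
by rewrite negb_or !negbK => /andP[/eqP-> /eqP->]; rewrite scale0r add0r emb0.
Qed.

(** The first [m] rows of a square Gabidulin code of minimum distance [n - m + d]: deleting [n - m]
    rows costs at most that much rank. For [d > m] the zero code has the required dimension. *)
Lemma mrd_code (F : finFieldType) (m n d : nat) :
    (0 < d)%N -> (d <= m -> m <= n)%N ->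
  exists V : {vspace 'M[F]_(m, n)}, \dim V = ((m + 1 - d) * n)%N
    /\ forall B, B \in V -> B != 0 -> (d <= \rank B)%N.
Proof.
move=> d_gt0; have [ltmd _ | ledm /(_ isT) lemn] := ltnP m d.
  exists 0%VS; rewrite dimv0; split; first by rewrite addn1 (eqP ltmd).
  by move=> B; rewrite memv0 => /eqP->; rewrite eqxx.
have n_gt0 : (0 < n)%N by lia.
have /(qpoly_spread F (Ordinal n_gt0))[_ [W [_ _ dimW rkW _]]] : (0 < m + 1 - d <= n)%N.
  by lia.
pose g (X : 'M[F]_n) : 'M[F]_(m, n) := pid_mx m *m X.
pose gL : {linear _ -> _} :=
  HB.pack g (GRing.isLinear.Build F _ _ *:%R g (linearP (mulmx (pid_mx m)))).
have rk_g X : X \in W -> X != 0 -> (d <= \rank (g X))%N.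
  move=> WX /(rkW X WX) rkX; have := mxrank_mul_min (pid_mx m : 'M[F]_(m, n)) X.
  by rewrite rank_pid_mx //; apply: leq_trans; lia.
exists (linfun gL @: W)%VS; split.
  rewrite limg_dim_eq //; apply/eqP; rewrite -subv0; apply/subvP=> X.
  rewrite memv_cap memv_ker lfunE /= memv0 => /andP[WX /eqP gX0].
  apply: contraT => /(rk_g X WX); rewrite gX0 mxrank0; lia.
move=> _ /memv_imgP[X WX ->]; rewrite lfunE /= => gX0; apply: rk_g => //.
by apply: contra_neq gX0 => ->; rewrite /g mulmx0.
Qed.

(** * Ranks of block matrices *)

Lemma mul_pid_mxE (F : fieldType) (m n i : nat) (A : 'M[F]_(m, n)) r c :
  (pid_mx i *m A : 'M_(m, n)) r c = if (r < i)%N then A r c else 0.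
Proof.
have -> : (pid_mx i *m A : 'M_(m, n)) r c = row r (pid_mx i *m A) 0 c by rewrite [RHS]mxE.
rewrite row_mul; case: ifP => [ltri | geri].
  by rewrite (@row_pid_mx _ _ _ _ _ r) // -rowE mxE.
by rewrite (_ : row r _ = 0) ?mul0mx ?mxE //; apply/rowP=> k; rewrite !mxE geri andbF.
Qed.

(** The first [i] rows contribute at most [i]; what remains lives in the last [t] columns. *)
Lemma rank_le_lines (F : fieldType) (m n i t : nat) (A : 'M[F]_(m, n)) :
    (forall r c, A r c != 0 -> (r < i)%N || (n <= c + t)%N) ->
  (\rank A <= i + t)%N.
Proof.
move=> A0; pose B := A - pid_mx i *m A.
have -> : A = pid_mx i *m A + B by rewrite addrC subrK.
apply: leq_trans (mxrank_add _ _) _; apply: leq_add.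
  apply: leq_trans (mxrankM_maxl _ _) _.
  by rewrite -pid_mx_minh rank_pid_mx ?geq_minl ?geq_minr.
have pidB : (pid_mx (n - t) : 'M_n) *m B^T = 0.
  apply/matrixP=> c r; rewrite mul_pid_mxE; case: ifP => ltc; rewrite !mxE //.
  have := mul_pid_mxE i A r c; rewrite mxE => ->.
  case: ifP => ltri; first by rewrite subrr.
  have [-> | /A0] := eqVneq (A r c) 0; first by rewrite subrr.
  by rewrite ltri /=; lia.
rewrite -mxrank_tr -[B^T]mul1mx -(subrK (pid_mx (n - t)) 1%:M) mulmxDl pidB addr0.
apply: leq_trans (mxrankM_maxl _ _) _; rewrite rank_copid_mx; lia.
Qed.

Lemma rank_block_lower (F : fieldType) (m1 n1 m3 n3 : nat)
    (A : 'M[F]_(m1, n1)) (D : 'M[F]_(m3, n3)) (E : 'M[F]_(m3, n1)) :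
  (\rank A + \rank D <= \rank (block_mx A 0 E D))%N.
Proof.
set X := block_mx _ _ _ _; pose f : 'M[F]_(n1 + n3, n3) := col_mx 0 1%:M.
rewrite -(mxrank_mul_ker X f) addnC leq_add //.
  by rewrite mul_block_col !mulmx0 !add0r mul0mx mulmx1 rank_col_0mx.
rewrite -(rank_row_mx0 n3 A); apply: mxrankS; rewrite sub_capmx; apply/andP; split.
  by rewrite /X block_mxEv -addsmxE addsmxSl.
by apply/sub_kermxP; rewrite mul_row_col mulmx0 mul0mx addr0.
Qed.

(** Since [v] is outside the row space of [A], some column [y] has [A *m y = 0] and [v *m y = 1].
    Adjoining the combination of columns given by [y] thus places [u] next to [D] and zeros next to
    [A], which reduces to [rank_block_lower]. *)
Lemma rank_block_corner (F : fieldType) (m1 n1 m3 n3 : nat)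
    (A : 'M[F]_(m1, n1)) (D : 'M[F]_(m3, n3)) (u : 'cV[F]_m3) (v : 'rV[F]_n1) :
    ~~ (v <= A)%MS ->
  (\rank A + \rank (row_mx u D) <= \rank (block_mx A 0 (u *m v) D))%N.
Proof.
rewrite submxE => /rV0Pn[j]; set c := _ 0 j => c0.
pose y := c^-1 *: col j (cokermx A).
have Ay : A *m y = 0 by rewrite -scalemxAr -col_mulmx mulmx_coker linear0 scaler0.
have vy : v *m y = 1%:M.
  rewrite -scalemxAr -col_mulmx (_ : col j _ = c%:M) ?scale_scalar_mx ?mulVf //.
  by apply/matrixP=> i k; rewrite !ord1 mxE [RHS]mxE eqxx.
pose Q : 'M_(n1 + n3, n1 + (1 + n3)) := block_mx 1%:M (row_mx y 0) 0 (row_mx 0 1%:M).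
have XQ : block_mx A 0 (u *m v) D *m Q = block_mx A 0 (u *m v) (row_mx u D).
  rewrite mulmx_block !mulmx0 !mulmx1 !mul0mx !addr0 !mul_mx_row !mulmx0 mulmx1 Ay.
  by rewrite -mulmxA vy mulmx1 row_mx0 add_row_mx addr0 add0r.
by rewrite (leq_trans (rank_block_lower A _ (u *m v))) // -XQ mxrankM_maxl.
Qed.

(** * Rows and columns of Ferrers diagrams *)

Lemma mem_upset (n : nat) (S : {set 'I_n}) :
    (forall j j' : 'I_n, val j' = (val j).+1 -> j \in S -> j' \in S) ->
  forall j, (j \in S) = (n <= j + #|S|)%N.
Proof.
move=> upS j.
have up (i k : 'I_n) : i \in S -> (i <= k)%N -> k \in S.
  move=> Si; case: k => k; elim: k => [|k IHk] ltkn /=.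
    by rewrite leqn0 => /eqP i0; rewrite (_ : Ordinal _ = i) //; apply: val_inj.
  rewrite leq_eqVlt => /orP[/eqP ik | leik].
    by rewrite (_ : Ordinal _ = i) //; apply: val_inj.
  exact: (upS (Ordinal (ltnW ltkn))) (IHk _ _).
have [Sj | nSj] := boolP (j \in S); apply/esym.
  have /subset_leq_card : [set k : 'I_n | j <= k < n]%N \subset S.
    by apply/subsetP=> k; rewrite inE => /andP[/up-> //].
  by rewrite card_ord_interval // leq_subLR.
apply/negbTE; have /subset_leq_card : S \subset [set k : 'I_n | j.+1 <= k < n]%N.
  apply/subsetP=> k Sk; rewrite inE ltn_ord andbT ltnNge.
  by apply: contra nSj; apply: up.
by rewrite card_ord_interval // leq_subRL // -ltnNge.
Qed.

Lemma row_dotsE (m n : nat) (D : {set 'I_m * 'I_n}) (i : 'I_m) :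
  row_dots D i = #|[set j | (i, j) \in D]|.
Proof.
rewrite -(card_imset [set j | (i, j) \in D] (f := pair i)); last by move=> j k [].
apply: eq_card => -[i' j]; rewrite !inE /=; apply/andP/imsetP => [[Dij /eqP ii']|].
  have {ii'} ii' : i' = i by apply: val_inj.
  by exists j; rewrite ?inE -?ii'.
by case=> j' /[!inE] Dij' [-> ->].
Qed.

Lemma col_dotsE (m n : nat) (D : {set 'I_m * 'I_n}) (j : 'I_n) :
  col_dots D j = #|[set i | (i, j) \in D]|.
Proof.
rewrite -(card_imset [set i | (i, j) \in D] (f := pair^~ j)); last by move=> i k [].
apply: eq_card => -[i j']; rewrite !inE /=; apply/andP/imsetP => [[Dij /eqP jj']|].
  have {jj'} jj' : j' = j by apply: val_inj.
  by exists i; rewrite ?inE -?jj'.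
by case=> i' /[!inE] Di'j [-> ->].
Qed.

Lemma sum_row_dots (m n a : nat) (D : {set 'I_m * 'I_n}) :
  (\sum_(a <= i < m) row_dots D i)%N = #|[set c in D | a <= c.1]|%N.
Proof.
rewrite card_row_sum (big_nat_widenl a 0) // big_mkord big_mkcond /=.
apply: eq_bigr => i _; rewrite row_dotsE; case: ifP => ai.
  by apply: eq_card => j; rewrite !inE /= ai andbT.
by apply/esym/eq_card0 => j; rewrite !inE /= ai andbF.
Qed.

Lemma sum_col_dots (m n : nat) (D : {set 'I_m * 'I_n}) :
  (\sum_(0 <= j < n) col_dots D j)%N = #|D|.
Proof.
rewrite big_mkord card_row_sum.
under eq_bigr => j _ do rewrite col_dotsE -sum1_card.
under [RHS]eq_bigr => i _ do rewrite -sum1_card.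
rewrite (exchange_big_dep xpredT) //=; apply: eq_bigr => i _.
by apply: eq_bigl => j; rewrite !inE.
Qed.

Lemma ferrers_row (m n : nat) (D : {set 'I_m * 'I_n}) :
  ferrers D -> forall (i : 'I_m) (j : 'I_n), ((i, j) \in D) = (n <= j + row_dots D i)%N.
Proof.
case=> _ rightD _ _ i j; rewrite row_dotsE -mem_upset ?inE // => k k' kk'.
by rewrite !inE; apply: rightD.
Qed.

Lemma ferrers_col (m n : nat) (D : {set 'I_m * 'I_n}) :
  ferrers D -> forall (i : 'I_m) (j : 'I_n), ((i, j) \in D) = (i < col_dots D j)%N.
Proof.
case=> upD _ _ _ i j; rewrite col_dotsE.
(* Columns are closed downwards, so the criterion applies to their complements. *)
have := @mem_upset m (~: [set k | (k, j) \in D]) _ i.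
rewrite !inE => /(_ _)/(canRL negbK)->; last first.
  by move=> k k' kk'; rewrite !inE; apply/contra/upD.
have := cardsC [set k | (k, j) \in D]; rewrite card_ord => cardS.
by rewrite -ltnNge -[X in (_ < X)%N = _]cardS ltn_add2r.
Qed.

Lemma ferrers_row_dots_anti (m n : nat) (D : {set 'I_m * 'I_n}) (i i' : nat) :
  ferrers D -> (i <= i' < m)%N -> (row_dots D i' <= row_dots D i)%N.
Proof.
move=> ferD /andP[leii' lti'm]; have ltim := leq_ltn_trans leii' lti'm.
rewrite (row_dotsE D (Ordinal lti'm)) (row_dotsE D (Ordinal ltim)).
apply/subset_leq_card/subsetP=> j; rewrite !inE !(ferrers_col ferD) /=.
exact: leq_ltn_trans.
Qed.

Lemma row_dots_le (m n : nat) (D : {set 'I_m * 'I_n}) (i : nat) :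
  (i < m)%N -> (row_dots D i <= n)%N.
Proof.
move=> ltim; rewrite (row_dotsE D (Ordinal ltim)) -[n in (_ <= n)%N]card_ord.
exact: max_card.
Qed.

Lemma col_dots_le (m n : nat) (D : {set 'I_m * 'I_n}) (j : nat) :
  (j < n)%N -> (col_dots D j <= m)%N.
Proof.
move=> ltjn; rewrite (col_dotsE D (Ordinal ltjn)) -[m in (_ <= m)%N]card_ord.
exact: max_card.
Qed.

(** * The upper bound on the dimension, and optimality *)

(** Were the dimension larger, some nonzero codeword would vanish on the dots counted by
    [ferrers_v]. It would be covered by [i] rows and [d - 1 - i] columns, so its rank would be below
    [d]. *)
Lemma ferrers_v_upper_bound (F : fieldType) (m n k d i : nat) (D : {set 'I_m * 'I_n})
    (C : {vspace 'M[F]_(m, n)}) :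
  ferrers_code D k d C -> (i < d)%N -> (k <= ferrers_v D d i)%N.
Proof.
case=> <- suppC rkC ltid.
pose S := [set c in D | (i <= c.1) && (c.2 + (d - 1 - i) < n)]%N.
have [W0 | ] := eqVneq (C :&: zero_on F S)%VS 0%VS.
  by apply: leq_trans (dimv_zero_on S _) _; rewrite W0 dimv0.
rewrite -vpick0; set A := vpick _ => A0.
have /memv_capP[CA /zero_onP zA] := memv_pick _ : A \in _.
have := rkC A CA A0; suffices : (\rank A <= i + (d - 1 - i))%N by lia.
apply: rank_le_lines => r c; apply: contraNT; rewrite negb_or -leqNgt -ltnNge => rc.
have [Drc | /suppC->//] := boolP ((r, c) \in D).
by rewrite zA // inE Drc.
Qed.

Lemma bigmin_seq_le (I : eqType) (s : seq I) (f : I -> nat) (x : nat) (i : I) :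
  i \in s -> (\big[minn/x]_(j <- s) f j <= f i)%N.
Proof.
elim: s => // j s IHs; rewrite inE big_cons => /orP[/eqP-> | /IHs les].
  exact: geq_minl.
exact: leq_trans (geq_minr _ _) les.
Qed.

(** As [k] is the term of index [d - 1] of the minimum, the upper bound forces [\dim C = k] and then
    makes that term the least. *)
Lemma optimal_of_dim (F : fieldType) (m n d : nat) (D : {set 'I_m * 'I_n})
    (C : {vspace 'M[F]_(m, n)}) (k := (\sum_(d - 1 <= i < m) row_dots D i)%N) :
    (0 < d)%N -> (k <= \dim C)%N ->
    (forall A : 'M[F]_(m, n), A \in C -> forall i j, (i, j) \notin D -> A i j = 0) ->
    (forall A : 'M[F]_(m, n), A \in C -> A != 0 -> (d <= \rank A)%N) ->
  optimal_ferrers_code D k d C.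
Proof.
move=> d_gt0 leCk suppC rkC.
have ltd : (d - 1 < d)%N by lia.
have vE : ferrers_v D d (d - 1) = k.
  rewrite /k sum_row_dots; apply: eq_card => c; rewrite !inE subnn addn0 ltn_ord.
  by rewrite andbT.
have codeC : ferrers_code D (\dim C) d C by [].
have dimC : \dim C = k.
  by apply/eqP; rewrite eqn_leq leCk -{1}vE (ferrers_v_upper_bound codeC).
rewrite dimC in codeC; split=> //; apply/eqP; rewrite eqn_leq; apply/andP; split.
  apply: (big_ind (leq k)) => [|x y kx ky|i _]; first exact: ferrers_v_upper_bound codeC _.
    by rewrite leq_min kx.
  exact: ferrers_v_upper_bound codeC _.
by rewrite -[X in (_ <= X)%N]vE (bigmin_seq_le _ _ (mem_index_enum (Ordinal ltd))).
Qed.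

(** * Folding a list of columns into the blocks *)

Section BlocksOfColumns.

Variables (F : fieldType) (m1 n1 m3 n3 : nat) (le31 : (m3 <= n1)%N).
Variables (i0 : 'I_m3) (j0 : 'I_n1).
Implicit Type T : 'M[F]_((m1 + n3).+1, n1).

(** Rows of a Ferrers diagram are right-justified, while the rows of [T] have their support at the
    left; hence the reversal of the column index. *)
Definition block_ul T : 'M[F]_(m1, n1) :=
  \matrix_(i, j) T (inord (m1 + n3 - i)) (rev_ord j).

Definition block_dr T : 'M[F]_(m3, n3) :=
  \matrix_(i, j) T (inord j.+1) (widen_ord le31 i).

Definition blocks_of_columns T : 'M[F]_(m1 + m3, n1 + n3) :=
  block_mx (block_ul T) 0 (T ord0 j0 *: delta_mx i0 (rev_ord j0)) (block_dr T).

Fact blocks_of_columns_linear : linear blocks_of_columns.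
Proof.
move=> a S T; rewrite /blocks_of_columns scale_block_mx add_block_mx scaler0 addr0.
congr block_mx; apply/matrixP=> i j; rewrite !mxE //.
by rewrite mulrDl mulrA.
Qed.

HB.instance Definition _ :=
  GRing.isLinear.Build F 'M[F]_((m1 + n3).+1, n1) 'M[F]_(m1 + m3, n1 + n3) *:%R
    blocks_of_columns blocks_of_columns_linear.

Hypotheses (i0E : val i0 = 0%N) (j0E : val j0 = 0%N).

(** If the row [v] of the corner entry lies in the row space of [A], then row 0 of [T] is already
    spanned by the reversed rows of [A], and [rank_block_lower] suffices. Otherwise
    [rank_block_corner] turns the corner entry into an extra column of [D]. *)
Lemma rank_blocks_of_columns T :
    (forall l, l != j0 -> T ord0 l = 0) ->
    (forall (k : 'I_(m1 + n3).+1) (l : 'I_n1),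
      (0 < k <= n3)%N -> (m3 <= l)%N -> T k l = 0) ->
  (\rank T <= \rank (blocks_of_columns T))%N.
Proof.
move=> T0 Tdr; rewrite /blocks_of_columns; set A := block_ul T; set D := block_dr T.
set e := T ord0 j0; pose v : 'rV[F]_n1 := delta_mx 0 (rev_ord j0).
(* [J] undoes the reversal in [block_ul], and [P] pads the columns of [D] with zeros from length
   [m3] to length [n1]. *)
pose J : 'M[F]_n1 := colsub (@rev_ord n1) 1%:M.
pose P : 'M[F]_(m3, n1) := pid_mx m3.
have mulJ p (B : 'M_(p, n1)) i l : (B *m J) i l = B i (rev_ord l).
  by rewrite mulmx_colsub mulmx1 mxE.
have mulP p (B : 'M_(p, m3)) i (l : 'I_n1) :
    (B *m P) i l = if insub (val l) is Some l' then B i l' else 0.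
  rewrite mxE; case: insubP => [l' _ l'E | ltl].
    rewrite (bigD1 l') //= big1 => [|k kl']; rewrite mxE -l'E ltn_ord andbT.
      by rewrite eqxx mulr1 addr0.
    by rewrite (_ : (k == l' :> nat) = (k == l')) // (negPf kl') mulr0.
  by rewrite big1 // => k _; rewrite mxE ltn_eqF ?mulr0 // (leq_trans (ltn_ord k)) // leqNgt.
have rowA (k : 'I_(m1 + n3).+1) : (n3 < k)%N -> (row k T <= A *m J)%MS.
  move=> ltk; have ltk' : (m1 + n3 - k < m1)%N by have := ltn_ord k; lia.
  suffices -> : row k T = row (Ordinal ltk') (A *m J) by apply: row_sub.
  apply/rowP=> l; rewrite mxE [RHS]mxE mulJ mxE rev_ordK; congr (T _ l).
  by apply: val_inj; rewrite /= inordK; have := ltn_ord k; lia.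
have rowD (k : 'I_(m1 + n3).+1) : (0 < k <= n3)%N -> (row k T <= D^T *m P)%MS.
  move=> kn; have ltk : (k.-1 < n3)%N by lia.
  suffices -> : row k T = row (Ordinal ltk) (D^T *m P) by apply: row_sub.
  apply/rowP=> l; rewrite mxE [RHS]mxE mulP; case: insubP => [l' _ l'E | ltl].
    rewrite !mxE; congr (T _ _); apply: val_inj => //=.
    by rewrite inordK; have := ltn_ord k; lia.
  by apply: Tdr; rewrite // leqNgt.
have row0 : row ord0 T = e *: delta_mx 0 j0.
  apply/rowP=> l; rewrite !mxE eqxx; have [-> | /T0->] := eqVneq l j0.
    by rewrite mulr1.
  by rewrite mulr0.
have rowT (k : 'I_(m1 + n3).+1) : [\/ k = ord0, (0 < k <= n3)%N | (n3 < k)%N].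
  have [k0|k_gt0] := posnP k; first by constructor 1; apply: val_inj.
  by have [lekn | ltnk] := leqP k n3; [constructor 2 | constructor 3].
pose u : 'cV[F]_m3 := e *: delta_mx i0 0.
have uv : e *: delta_mx i0 (rev_ord j0) = u *m v.
  by rewrite -scalemxAl mul_delta_mx.
have [vA | vA] := boolP (v <= A)%MS.
  apply: leq_trans (rank_block_lower A D _).
  apply: (@leq_trans (\rank (A *m J + D^T *m P)%MS)); last first.
    apply: leq_trans (mxrank_adds_leqif _ _) _; apply: leq_add.
      exact: mxrankM_maxl.
    by rewrite -[\rank D]mxrank_tr mxrankM_maxl.
  apply/mxrankS/row_subP=> k; case: (rowT k) => [-> | /rowD kT | /rowA kT].
  - apply: submx_trans (addsmxSl _ _); rewrite row0 (_ : delta_mx 0 j0 = v *m J).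
      by rewrite scalemx_sub // submxMr.
    apply/rowP=> l; rewrite mulJ !mxE; congr ((_ && _)%:R).
    by rewrite (inj_eq rev_ord_inj).
  - exact: submx_trans kT (addsmxSr _ _).
  exact: submx_trans kT (addsmxSl _ _).
rewrite uv; apply: leq_trans (rank_block_corner D u vA).
apply: (@leq_trans (\rank (A *m J + (row_mx u D)^T *m P)%MS)); last first.
  apply: leq_trans (mxrank_adds_leqif _ _) _; apply: leq_add.
    exact: mxrankM_maxl.
  by rewrite -[\rank (row_mx u D)]mxrank_tr mxrankM_maxl.
rewrite tr_row_mx mul_col_mx.
apply/mxrankS/row_subP=> k; case: (rowT k) => [-> | /rowD kT | /rowA kT].
- apply: submx_trans (addsmxSr _ _); rewrite -addsmxE.
  apply: submx_trans (addsmxSl _ _); rewrite row0 (_ : e *: _ = u^T *m P) //.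
  rewrite linearZ /= trmx_delta -scalemxAl; congr (_ *: _).
  rewrite -rowE (@row_pid_mx _ _ _ _ _ j0) //.
  by rewrite i0E j0E.
- apply: submx_trans kT _; apply: submx_trans (addsmxSr _ _).
  by rewrite -addsmxE addsmxSr.
exact: submx_trans kT (addsmxSl _ _).
Qed.

End BlocksOfColumns.

(** * The sorted sequence and the dots of the glued diagram *)

(** At least [d - 1] terms reach [m1 + n3]. If row [d - 2] of [D1] fell short, so would the later
    rows, the columns of [D3] (at most [m3] high) and the term 1, leaving only [d - 2] rows. *)
Lemma alpha_top (m1 n1 m3 n3 d : nat)
    (D1 : {set 'I_m1 * 'I_n1}) (D3 : {set 'I_m3 * 'I_n3}) :
    ferrers D1 -> (0 < m1)%N -> (0 < n3)%N -> (2 <= d <= m1 + 1)%N ->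
    (m3 <= row_dots D1 (d - 2))%N ->
    (m1 + n3 <= nth 0 (alpha_seq D1 D3) (m1 + n3 - d + 2))%N ->
  (m1 + n3 <= row_dots D1 (d - 2))%N.
Proof.
move=> ferD m1_gt0 n3_gt0 /andP[d_ge2 d_le]; set M := row_dots D1 _ => leM.
set X := (m1 + n3)%N; set p := (_ - d + 2)%N; set s := alpha_seq _ _ => leXs.
rewrite leqNgt; apply/negP=> ltMX.
have size_s : size s = X.+1 by rewrite size_sort /= size_cat !size_map !size_iota.
have sorted_s : sorted leq s by apply: sort_sorted; apply: leq_total.
(* The terms from index [p] on number [X.+1 - p = d - 1]. *)
have : (d - 1 <= count (leq X) s)%N.
  rewrite -(cat_take_drop p s) count_cat.
  have /eqP -> : count (leq X) (drop p s) == size (drop p s).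
    rewrite -all_count; apply/(all_nthP 0) => i; rewrite size_drop nth_drop => ltis.
    apply: leq_trans leXs _; apply: (sorted_leq_nth leq_trans leqnn 0 sorted_s).
    - by rewrite inE size_s /p /X; lia.
    - by rewrite inE -ltn_subRL.
    by rewrite leq_addr.
  by rewrite size_drop size_s /p /X; lia.
rewrite (seq.permP (permEl (perm_sort leq _))) /= count_cat !count_map.
have -> : (X <= 1)%N = false by rewrite /X; lia.
rewrite add0n [X in (_ + X)%N](_ : _ = 0%N) ?addn0; last first.
  apply/eqP; rewrite -leqn0 leqNgt -has_count; apply/hasPn => j; rewrite mem_iota /= => jn.
  by rewrite -ltnNge (leq_ltn_trans (col_dots_le D3 _)) // (leq_ltn_trans leM).
have -> : iota 0 m1 = iota 0 (d - 2) ++ iota (d - 2) (m1 - (d - 2)).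
  by rewrite -iotaD subnKC //; lia.
rewrite count_cat [X in (_ + X)%N](_ : _ = 0%N) ?addn0; last first.
  apply/eqP; rewrite -leqn0 leqNgt -has_count; apply/hasPn => i; rewrite mem_iota /= => im.
  rewrite -ltnNge (leq_ltn_trans _ ltMX) // ferrers_row_dots_anti //; lia.
apply/negP; rewrite -ltnNge.
by apply: leq_ltn_trans (count_size _ _) _; rewrite size_iota; lia.
Qed.

Section GlueCard.

Variables (m1 n1 m3 n3 : nat).
Variables (D1 : {set 'I_m1 * 'I_n1}) (D3 : {set 'I_m3 * 'I_n3}).
Local Notation G := (ferrers_glue D1 D3).

Let ul (c : 'I_m1 * 'I_n1) : 'I_(m1 + m3) * 'I_(n1 + n3) := (lshift m3 c.1, lshift n3 c.2).
Let dr (c : 'I_m3 * 'I_n3) : 'I_(m1 + m3) * 'I_(n1 + n3) := (rshift m1 c.1, rshift n1 c.2).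
Let box (a b a' b' : nat) : {set 'I_(m1 + m3) * 'I_(n1 + n3)} :=
  setX [set i : 'I_(m1 + m3) | a <= i < b]%N [set j : 'I_(n1 + n3) | a' <= j < b']%N.

Let card_box a b a' b' :
  (b <= m1 + m3)%N -> (b' <= n1 + n3)%N -> #|box a b a' b'| = ((b - a) * (b' - a'))%N.
Proof. by move=> leb leb'; rewrite cardsX !card_ord_interval. Qed.

Lemma row_dots_glue (i : nat) : (i < m1)%N -> (row_dots G i <= row_dots D1 i + n3)%N.
Proof.
move=> im; have cardB : #|box i i.+1 n1 (n1 + n3)| = n3 by rewrite card_box; lia.
apply: (@leq_trans (#|ul @: [set c in D1 | val c.1 == i]| + #|box i i.+1 n1 (n1 + n3)|)).
  apply: leq_trans (leq_card_setU _ _); apply/subset_leq_card/subsetP => c.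
  rewrite !inE => /andP[/orP[/orP[/orP[/imsetP[c1 D1c1 ->] | /andP[/eqP c1 _]] | c_ur] |
    /imsetP[c3 _ ->]]] /eqP ci.
  - by apply/orP; left; apply/imsetP; exists c1; rewrite // inE D1c1 -ci eqxx.
  - by move: im; rewrite -ci c1 ltnn.
  - apply/orP; right; rewrite ltn_ord andbT.
    by case/andP: c_ur => _ ->; rewrite -ci leqnn ltnSn.
  by move: im; rewrite -ci /= ltnNge leq_addr.
by rewrite cardB leq_add2r leq_imset_card.
Qed.

(** A union bound over the four pieces suffices, since [optimal_of_dim] asks only for a code at
    least this large. *)
Lemma sum_row_dots_glue (a : nat) : (0 < n1)%N -> (0 < m3)%N -> (a <= m1)%N ->
  (\sum_(a <= i < m1 + m3) row_dots G i
   <= \sum_(a <= i < m1) row_dots D1 i + 1 + (m1 - a) * n3 + #|D3|)%N.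
Proof.
move=> n1_gt0 m3_gt0 am; rewrite !sum_row_dots.
have cardP : #|box m1 m1.+1 n1.-1 n1| = 1%N by rewrite card_box; lia.
have cardB : #|box a m1 n1 (n1 + n3)| = ((m1 - a) * n3)%N.
  by rewrite card_box ?addKn ?leq_addr.
apply: (@leq_trans (#|ul @: [set c in D1 | (a <= c.1)%N]| + #|box m1 m1.+1 n1.-1 n1|
  + #|box a m1 n1 (n1 + n3)| + #|dr @: D3|)%N); last first.
  by rewrite cardB cardP !leq_add ?leq_imset_card.
apply: leq_trans (leq_add (leq_add (leq_card_setU _ _) (leqnn _)) (leqnn _)).
apply: leq_trans (leq_add (leq_card_setU _ _) (leqnn _)).
apply: leq_trans (leq_card_setU _ _); apply/subset_leq_card/subsetP => c.
rewrite !inE => /andP[/orP[/orP[/orP[/imsetP[c1 D1c1 ->] | c_p] | c_ur] |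
  /imsetP[c3 D3c3 ->]]] ac.
- by do 3![apply/orP; left]; apply/imsetP; exists c1; rewrite // inE D1c1.
- by do 2![apply/orP; left]; apply/orP; right; case/andP: c_p => /eqP-> /eqP->; lia.
- apply/orP; left; apply/orP; right; rewrite ltn_ord andbT.
  by case/andP: c_ur => -> ->; rewrite ac.
by apply/orP; right; apply/imsetP; exists c3.
Qed.

End GlueCard.

(** * Assembling the code *)

Lemma dimv_add_limg (F : fieldType) (aT bT rT : vectType F)
    (f : 'Hom(aT, rT)) (g : 'Hom(bT, rT)) (A : {vspace aT}) (B : {vspace bT}) :
    (forall x y, x \in A -> y \in B -> f x + g y = 0 -> x = 0 /\ y = 0) ->
  \dim (f @: A + g @: B)%VS = (\dim A + \dim B)%N.
Proof.
move=> inj; rewrite dimv_disjoint_sum.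
  congr (_ + _)%N; apply: limg_dim_eq; apply/eqP; rewrite -subv0; apply/subvP=> x;
    rewrite memv_cap memv_ker memv0 => /andP[xA /eqP fx0].
    by have [|||-> _] := inj x 0; rewrite ?mem0v ?linear0 ?addr0.
  by have [|||_ ->] := inj 0 x; rewrite ?mem0v ?linear0 ?add0r.
apply/eqP; rewrite -subv0; apply/subvP=> z; rewrite memv_cap memv0.
case/andP=> /memv_imgP[x xA ->] /memv_imgP[y yB fxgy].
have [|||-> _] := inj x (- y); rewrite ?memvN ?linear0 //.
by rewrite linearN fxgy subrr.
Qed.

(** Distance 1 admits every matrix supported on the diagram. The case is separate because hypotheses
    (3) and (4) speak only from [d = 2] on. *)
Lemma trivial_ferrers_code (F : fieldType) (m n : nat) (D : {set 'I_m * 'I_n}) :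
  exists C : {vspace 'M[F]_(m, n)},
    optimal_ferrers_code D (\sum_(1 - 1 <= i < m) row_dots D i)%N 1 C.
Proof.
exists (zero_on F (~: D)); apply: optimal_of_dim => //.
- rewrite subnn sum_row_dots (_ : [set c in D | _] = D); last first.
    by apply/setP=> c; rewrite inE andbT.
  have := dimv_zero_on (~: D) {:'M[F]_(m, n)}; rewrite capfv dimvf /dim /=.
  by have := cardsC D; rewrite card_prod !card_ord => <-; rewrite leq_add2r.
- by move=> A /zero_onP A0 i j ij; apply: A0; rewrite inE.
by move=> A _; rewrite lt0n mxrank_eq0.
Qed.

Definition upper_right (F : fieldType) (m1 n1 m3 n3 : nat) (B : 'M[F]_(m1, n3)) :
  'M[F]_(m1 + m3, n1 + n3) := block_mx 0 B 0 0.

Fact upper_right_linear (F : fieldType) (m1 n1 m3 n3 : nat) :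
  linear (@upper_right F m1 n1 m3 n3).
Proof.
by move=> a A B; rewrite /upper_right scale_block_mx add_block_mx !scaler0 !addr0.
Qed.

HB.instance Definition _ (F : fieldType) (m1 n1 m3 n3 : nat) :=
  GRing.isLinear.Build F 'M[F]_(m1, n3) 'M[F]_(m1 + m3, n1 + n3) *:%R
    (@upper_right F m1 n1 m3 n3) (@upper_right_linear F m1 n1 m3 n3).

Section ColumnHeights.

Variables (m1 n1 m3 n3 : nat).
Variables (D1 : {set 'I_m1 * 'I_n1}) (D3 : {set 'I_m3 * 'I_n3}).

(* Column 0 is the single dot, columns 1 to n3 are the columns of D3, and the
   rows of D1 follow in reverse order, so that the longest ones come last. *)
Definition heights (k : nat) : nat :=
  if k == 0%N then 1%N
  else if (k <= n3)%N then col_dots D3 k.-1 else row_dots D1 (m1 + n3 - k).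

(** For [t = d - 1] the range ends at [r], and what it leaves out are the first [d - 1] rows of
    [D1], the redundant columns. *)
Lemma sum_heights (t : nat) : (t <= m1)%N ->
  (\sum_(1 <= k < (n3 + (m1 - t)).+1) heights k
   = #|D3| + \sum_(t <= i < m1) row_dots D1 i)%N.
Proof.
move=> le_t; rewrite (@big_cat_nat _ _ _ n3.+1) //=; last by lia.
congr (_ + _)%N.
  rewrite -(sum_col_dots D3) big_add1 /=; apply: eq_big_nat => k /andP[_ kn].
  by rewrite /heights /= kn.
rewrite -[n3.+1 in LHS]add0n big_addn -[t in RHS]add0n big_addn [RHS]big_nat_rev.
have -> : ((n3 + (m1 - t)).+1 - n3.+1 = m1 - t)%N by lia.
apply: eq_big_nat => i it; rewrite /heights.
have -> : (i + n3.+1 == 0)%N = false by lia.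
have -> : (i + n3.+1 <= n3)%N = false by lia.
by congr row_dots; lia.
Qed.

End ColumnHeights.

Local Close Scope ring_scope.

Theorem theorem4p11 (Fq : finFieldType) (m1 n1 m3 n3 d : nat)
    (D1 : {set 'I_m1 * 'I_n1}) (D3 : {set 'I_m3 * 'I_n3})
    (hm1 : 0 < m1) (hn1 : 0 < n1) (hm3 : 0 < m3) (hn3 : 0 < n3)
    (hD1 : ferrers D1) (hD3 : ferrers D3)
    (hd0 : 0 < d) (hd : d <= m1 + 1)
    (h1 : d < m1 + 1 -> m1 <= n3)
    (h2 : 1 + m1 + n3 <= maxn n1 m3)
    (h3 : 2 <= d -> m1 + n3 <= nth 0 (alpha_seq D1 D3) (m1 + n3 - d + 2))
    (h4 : 2 <= d -> m3 <= row_dots (ferrers_glue D1 D3) (d - 2) - n3) :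
  exists C : {vspace 'M[Fq]_(m1 + m3, n1 + n3)},
    optimal_ferrers_code (ferrers_glue D1 D3)
      (\sum_(d - 1 <= i < m1 + m3) row_dots (ferrers_glue D1 D3) i) d C.
Proof.
have [d1 | d_gt1] := leqP d 1.
  have -> : d = 1 by lia.
  exact: trivial_ferrers_code.
pose n := m1 + n3; pose M := row_dots D1 (d - 2); pose r := n + 1 - d.
have lt_d2 : d - 2 < m1 by lia.
have le3M : m3 <= M by have := h4 d_gt1; have := row_dots_glue D1 D3 lt_d2; rewrite -/M; lia.
have leM1 : M <= n1 by apply: row_dots_le.
have lenM : n <= M by apply: alpha_top (h3 d_gt1) => //; lia.
(* Since [m3 <= M <= n1], the maximum in (2) is [n1]. *)
have lt_n1 : n < n1 by move: h2; rewrite /n; lia.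
pose a := heights D1 D3.
have a_ul (i : nat) : i < m1 -> a (n - i) = row_dots D1 i.
  move=> im; rewrite /a /heights; have -> : (n - i == 0) = false by rewrite /n; lia.
  have -> : (n - i <= n3) = false by rewrite /n; lia.
  by congr row_dots; rewrite /n; lia.
have a_dr (j : nat) : j < n3 -> a j.+1 = col_dots D3 j by rewrite /a /heights /= => ->.
have rho0 : row_dots D1 0 = n1 by case: hD1.
have [V2 [dimV2 suppV2 rkV2]] : exists V : {vspace 'M[Fq]_(n.+1, n1)},
    [/\ 1 + \sum_(1 <= j < r.+1) a j <= \dim V,
        forall A, A \in V -> forall j i, a (val j) <= val i -> A j i = 0%R
      & forall A, A \in V -> A != 0%R -> n < \rank A + r].
  (* [M] separates the heights: an index [j] beyond [n3] stands for row [n - j] of [D1], which is at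
     least [d - 1] when [j <= r] and at most [d - 2] when [j > r]; columns of [D3] have height at
     most [m3 <= M]. *)
  apply: (@column_code Fq n1 n M r a) => //.
  - by rewrite /r /n; lia.
  - by rewrite lenM.
  - by rewrite -[n in a n]subn0 a_ul // rho0.
  - move=> [//|j] /= jr; have [jn | nj] := ltnP j n3.
      by rewrite a_dr // (leq_trans (col_dots_le D3 jn)).
    rewrite -(@subKn j.+1 n) ?a_ul; try by rewrite /r /n in jr *; lia.
    by apply: ferrers_row_dots_anti => //; rewrite /r /n in jr *; lia.
  move=> j jr; rewrite -(@subKn j n) ?a_ul; try by rewrite /r /n in jr *; lia.
  by apply: ferrers_row_dots_anti => //; rewrite /r /n in jr *; lia.
have [V1 [dimV1 rkV1]] : exists V : {vspace 'M[Fq]_(m1, n3)},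
    \dim V = (m1 + 1 - d) * n3 /\ forall B, B \in V -> B != 0%R -> d <= \rank B.
  by apply: mrd_code => // le_d; apply: h1; rewrite addn1.
have le31 : m3 <= n1 by apply: leq_trans leM1.
pose i0 := Ordinal hm3; pose j0 := Ordinal hn1.
pose f := blocks_of_columns le31 i0 j0 : 'M[Fq]_(n.+1, n1) -> _.
pose g := @upper_right Fq m1 n1 m3 n3.
have fE X : linfun (blocks_of_columns le31 i0 j0) X = f X by rewrite lfunE.
have gE B : linfun g B = g B by rewrite lfunE.
have fgE X B : (f X + g B = block_mx (block_ul X) B
    (X ord0 j0 *: delta_mx i0 (rev_ord j0)) (block_dr le31 X))%R.
  by rewrite /f /g /blocks_of_columns /upper_right add_block_mx !addr0 add0r.
have rk_fg X B : X \in V2 -> B \in V1 -> (X != 0%R) || (B != 0%R) ->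
    d <= \rank (f X + g B)%R.
  move=> XV2 BV1; have [-> | B0 _] := eqVneq B 0%R; last first.
    apply: leq_trans (rkV1 B BV1 B0) _.
    have subB : (row_mx 1%:M 0 *m (f X + g B) *m col_mx 0 1%:M = B)%R.
      by rewrite fgE mul_row_block !mul1mx !mul0mx !addr0 mul_row_col mulmx0 mulmx1 add0r.
    by rewrite -{1}subB (leq_trans (mxrankM_maxl _ _)) // mxrankM_maxr.
  rewrite orbF /g linear0 addr0 => /(rkV2 X XV2) rkX.
  suffices : \rank X <= \rank (f X) by rewrite /r /n in rkX *; lia.
  apply: rank_blocks_of_columns => // [l l0 | k l kn le3l]; apply: suppV2 => //.
    by rewrite /= lt0n.
  by apply: leq_trans le3l; case: k kn => -[//|k] ? /= kn; rewrite a_dr // col_dots_le.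
exists (linfun (blocks_of_columns le31 i0 j0) @: V2 + linfun g @: V1)%VS.
apply: optimal_of_dim => //.
- rewrite dimv_add_limg.
    apply: leq_trans (sum_row_dots_glue _ _ _ _ _) _ => //; first lia.
    rewrite dimV1; move: dimV2; rewrite (_ : r = n3 + (m1 - (d - 1))); last by rewrite /r /n; lia.
    rewrite sum_heights; last lia.
    have -> : m1 + 1 - d = m1 - (d - 1) by lia.
    move=> leV2; rewrite addnAC leq_add2r; apply: leq_trans leV2.
    by rewrite -addnA addnC -addnA.
  move=> X B XV2 BV1; rewrite fE gE => fg0; have := rk_fg X B XV2 BV1.
  rewrite fg0 mxrank0 leqNgt hd0 /=.
  by case: (eqVneq X 0%R) => [->|_]; case: (eqVneq B 0%R) => [->|_] //= /(_ isT).
- move=> _ /memv_addP[_ /memv_imgP[X XV2 ->] [_ /memv_imgP[B BV1 ->] ->]] i j.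
  rewrite fE gE fgE !inE !negb_or -!andbA => /and4P[].
  case: (split_ordP i) => i' ->; case: (split_ordP j) => j' ->.
  + rewrite block_mxEul mxE => ij _ _ _; apply: suppV2; rewrite //= inordK ?ltnS ?leq_subr //.
    rewrite a_ul //; move: ij; apply: contraNT => le_row; apply/imsetP; exists (i', j') => //.
    rewrite ferrers_row //; lia.
  + by move=> _ _ /negP[]; rewrite /= leq_addr.
  + rewrite block_mxEdl mxE [X in (_ * X)%R]mxE => _ ij _ _.
    case: eqP => [i'0|]; last by rewrite mulr0.
    case: eqP => [j'0|]; last by rewrite mulr0.
    move: ij; rewrite i'0 j'0 /=; lia.
  rewrite block_mxEdr mxE => _ _ _ ij; apply: suppV2; rewrite //= inordK; last by have := ltn_ord j'; lia.
  rewrite a_dr // leqNgt; apply: contra ij => lt_col; apply/imsetP; exists (i', j') => //.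
  by rewrite ferrers_col.
move=> _ /memv_addP[_ /memv_imgP[X XV2 ->] [_ /memv_imgP[B BV1 ->] ->]].
rewrite fE gE => fg0; apply: rk_fg => //; apply: contraNT fg0.
by rewrite negb_or !negbK => /andP[/eqP-> /eqP->]; rewrite /f /g !linear0 addr0.
Qed.
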